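(* Let $G$ be a finite simple (unweighted) graph with adjacency matrix $A$, and suppose perfect state transfer occurs between two vertices of $G$. If $t$ is the minimum positive time at which this perfect state transfer occurs, then $t\le\pi/\sqrt{2}$.
   Context: Perfect state transfer between distinct vertices $i$ and $j$ at time $t>0$ means $\exp(\mathrm{i}tA)e_i=\gamma e_j$ for some $\gamma\in\mathbb{C}$ with $|\gamma|=1$, where $e_i,e_j$ are the standard basis vectors of the vertices. *)

(* Defs.v *)
From HB Require Import structures.
From mathcomp Require Import all_boot all_order all_algebra.
From mathcomp Require Import all_classical all_reals.
From mathcomp Require Import topology normedtype sequences trigo.
From mathcomp Require Import complex.
Set Implicit Arguments. Unset Strict Implicit. Unset Printing Implicit Defensive.
Import Order.TTheory GRing.Theory Num.Theory numFieldNormedType.Exports.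
Local Open Scope ring_scope.

Definition simple_graph (n : nat) (e : rel 'I_n) : Prop :=
  symmetric e /\ irreflexive e.

Definition adjmx (R : realType) (n : nat) (e : rel 'I_n) : 'M[R]_n :=
  \matrix_(u, v) (e u v)%:R.

Definition expcoef (R : realType) (t : R) (k : nat) : R[i] :=
  (('i%C * (t%:C)%C) ^+ k) / (k`!)%:R.

(* exp(i t A) for a real square matrix A, defined entrywise as the
   exponential power series  sum_k (i t)^k/k! A^k ; the complex series
   is summed through its real and imaginary parts (limits in R). *)
Definition expitA (R : realType) (n : nat) (A : 'M[R]_n) (t : R) : 'M[R[i]]_n :=
  \matrix_(u, v)
    Complex (limn (series (fun k : nat => @complex.Re R (expcoef t k) * (A ^+ k) u v : R) : R^nat))
            (limn (series (fun k : nat => @complex.Im R (expcoef t k) * (A ^+ k) u v : R) : R^nat)).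

Definition pst (R : realType) (n : nat) (A : 'M[R]_n) (a b : 'I_n) (t : R) : Prop :=
  exists gamma : R[i], `|gamma| = 1 /\
    forall u : 'I_n, expitA A t u a = gamma * (u == b)%:R.

(* Main.v *)
Require Import Defs.
From HB Require Import structures.
From mathcomp Require Import all_boot all_order all_algebra.
From mathcomp Require Import all_classical all_reals.
From mathcomp Require Import topology normedtype sequences trigo.
From mathcomp Require Import complex.
From mathcomp Require Import ring lra zify.
Import Order.TTheory GRing.Theory Num.Theory numFieldNormedType.Exports.
Local Open Scope ring_scope.

Set Implicit Arguments. Unset Strict Implicit. Unset Printing Implicit Defensive.

(** Write the adjacency matrix as [A = P^-1 diag(d) P] with [P] and [d] real, and call
    an eigenvalue [d_j] positive (negative) if [P_ja + P_jb <> 0] ([P_ja - P_jb <> 0]).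
    Perfect state transfer at time [t] makes the two classes disjoint and every
    difference of a positive and a negative eigenvalue an odd multiple of [pi / t].
    Let [g] be the gcd of these odd integers. Then transfer already occurs at time
    [t / g], so it suffices to show [be >= sqrt 2] for [be := pi g / t].

    The real number [be] is an algebraic integer, being an integral combination of
    eigenvalues. Its square is rational: the polynomials whose roots are the distinct
    positive (resp. negative) eigenvalues are the minimal polynomials of [e_a + e_b]
    and [e_a - e_b] relative to [A], so they have rational coefficients, and hence the
    sum of the squares of all differences, an integer multiple of [be^2], is rational.
    So [be^2] is a positive integer, and only [be = 1] has to be excluded. In that case
    the shifted matrix [A - th] ([th] a negative eigenvalue) satisfies [f (e_a + e_b) = 0]
    and [h (e_a - e_b) = 0] with integer polynomials [f] and [h] that are coprime modulo 2.
    As [e_a + e_b] and [e_a - e_b] agree modulo 2, this makes [e_a + e_b] divisible by 2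
    over the algebraic integers, which is absurd. *)

(** * Algebraic integers and power sums of roots *)

Local Notation integral := (integralOver (intr : int -> _)).

(** Gauss's lemma in the linear case: [L = denq q * X - numq q] has coprime coefficients, hence
    content 1, and it divides the monic integer polynomial [p] over the integers. So its leading
    coefficient [denq q] is a unit. *)
Lemma integral_ratr (K : numFieldType) (q : rat) :
  integral (ratr q : K) -> exists z : int, q = z%:~R.
Proof.
case=> p p_monic.
have -> : map_poly (intr : int -> K) p = map_poly ratr (map_poly (intr : int -> rat) p).
  by rewrite -map_poly_comp; apply: eq_map_poly => z /=; rewrite ratr_int.
rewrite fmorph_root => pq.
pose L : {poly int} := (denq q)%:P * 'X - (numq q)%:P.
have LE : map_poly (intr : int -> rat) L = (denq q)%:~R *: ('X - q%:P).
  rewrite /L rmorphB rmorphM /= map_polyX !map_polyC /= scalerBr -mul_polyC.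
  congr (_ - _); rewrite -mul_polyC -polyCM; congr (_%:P).
  by rewrite mulrC -{2}[q]divq_num_den divfK // intr_eq0 denq_neq0.
have Lp : (L %| p)%R.
  by rewrite -dvdp_rat_int LE dvdpZl ?dvdp_XsubCl ?intr_eq0 ?denq_neq0.
have [r Dp] := dvdpP_int Lp.
have L1 : L`_1 = denq q.
  by rewrite /L coefB coefMX !coefC /= subr0.
have L0 : L`_0 = - numq q.
  by rewrite /L coefB coefMX !coefC /= sub0r.
have sL : size L = 2.
  rewrite /L -polyCN mul_polyC size_polyDl size_scale ?denq_neq0 ?size_polyX //.
  exact: leq_ltn_trans (size_polyC_leq1 _) _.
have c1 : (`|zcontents L| = 1)%N.
  have dv i : (zcontents L %| L`_i)%Z.
    by have := dvdz_contents (zcontents L) L; rewrite dvdzz => /esym/polyOverP/(_ i).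
  have := dv 0%N; have := dv 1%N; rewrite L0 L1 !dvdzE abszN => d1 d0.
  have : (`|zcontents L| %| gcdn `|numq q| `|denq q|)%N by rewrite dvdn_gcd d0.
  by have /eqP -> := coprime_num_den q; rewrite dvdn1 => /eqP.
have l1 : (`|lead_coef (zprimitive L)| = 1)%N.
  move/monicP: p_monic; rewrite Dp lead_coefM => /(congr1 absz).
  by rewrite abszM => /eqP; rewrite muln_eq1 => /andP[/eqP].
have : (`|denq q| = 1)%N.
  have -> : denq q = lead_coef L by rewrite lead_coefE sL.
  have -> : lead_coef L = zcontents L * lead_coef (zprimitive L).
    by rewrite -lead_coefZ -zpolyEprim.
  by rewrite abszM c1 l1.
move=> dq; exists (numq q).
by rewrite -{1}[q]divq_num_den -absz_denq dq divr1.
Qed.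

(** Newton's identities for the first two power sums. Multiplying [F] by ['X] or ['X^2] moves the
    second or third highest coefficient to index [size s], and gives 0 there when [s] is too
    short. *)
Lemma prod_XsubC_top_coefs (K : comNzRingType) (s : seq K) :
  let F := \prod_(x <- s) ('X - x%:P) in
  ('X * F)`_(size s) = - \sum_(x <- s) x /\
  ('X^2 * F)`_(size s) *+ 2 = (\sum_(x <- s) x) ^+ 2 - \sum_(x <- s) x ^+ 2.
Proof.
elim: s => [|c s [IH1 IH2]] /=.
  by rewrite !big_nil !mulr1 coefX coefXn /=; split; ring.
have lead1 : (\prod_(x <- s) ('X - x%:P) : {poly K})`_(size s) = 1.
  have /monicP := monic_prod_XsubC s xpredT id.
  by rewrite lead_coefE size_prod_XsubC.
rewrite !big_cons; move: lead1 IH1 IH2.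
set F := \prod_(x <- s) _ => lead1 IH1 IH2; split.
  rewrite coefXM /= mulrBl coefB IH1 coefCM lead1; ring.
have -> : 'X^2 * (('X - c%:P) * F) = 'X * (('X^2 * F) - c%:P * ('X * F)) by ring.
rewrite coefXM /= coefB coefCM mulrnBl IH2 IH1; ring.
Qed.

(** * Bezout identities modulo 2 and odd gcds *)

(** A Bezout identity modulo 2, lifted to integer coefficients with error term [2 W], so that it can
    be evaluated at a matrix of algebraic integers. *)
Definition coprime_mod2 (f h : {poly int}) :=
  exists U V W : {poly int}, U * f + V * h = 1 + W *+ 2.

Lemma coprime_mod2C f h : coprime_mod2 f h -> coprime_mod2 h f.
Proof. by case=> U [V [W E]]; exists V, U, W; rewrite addrC. Qed.

Lemma coprime_mod2_prod (I : Type) (r : seq I) (P : pred I) (f : I -> {poly int}) h :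
  (forall i, P i -> coprime_mod2 (f i) h) -> coprime_mod2 (\prod_(i <- r | P i) f i) h.
Proof.
move=> fh; elim/big_ind: _ => //; first by exists 1, 0, 0; ring.
move=> f1 f2 [U1 [V1 [W1 E1]]] [U2 [V2 [W2 E2]]].
(* Multiply the two identities: every term except [U1 * U2 * f1 * f2] contains the factor [h]. *)
exists (U1 * U2), (V1 * (U2 * f2 + V2 * h) + U1 * f1 * V2), (W1 + W2 + W1 * W2 *+ 2).
transitivity ((U1 * f1 + V1 * h) * (U2 * f2 + V2 * h)); first ring.
rewrite E1 E2; ring.
Qed.

Lemma coprime_mod2_XsubC (x y : int) :
  odd `|x - y| -> coprime_mod2 ('X - x%:P) ('X - y%:P).
Proof.
move=> oxy; have [w yx] : exists w : int, y - x = w *+ 2 + 1.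
  by exists ((y - x - 1) %/ 2)%Z; lia.
exists 1, (-1), (w%:P); rewrite mul1r mulN1r -polyCMn.
have -> : y = x + w *+ 2 + 1 by lia.
rewrite !polyCD; ring.
Qed.

(** Bezout writes [al] times the gcd as an integer combination of the integral numbers [al * m]; the
    gcd is odd because it divides an odd number. *)
Lemma odd_gcd_combination (K : comNzRingType) (al : K) (s : seq int) :
  (forall m, m \in s -> odd `|m| /\ integral (al * m%:~R)) -> s != [::] ->
  exists g : nat, [/\ odd g, (forall m, m \in s -> (g%:Z %| m)%Z) & integral (al * g%:R)].
Proof.
elim: s => // m s IH ms _.
have [om im] := ms m (mem_head _ _).
have abs_int (z : int) : integral (al * z%:~R) -> integral (al * `|z|%:R).
  rewrite pmulrn abszE; case: (ger0P z) => _ // /integral_opp.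
  by rewrite rmorphN /= mulrN.
have [s0|sN0] := eqVneq s [::].
  exists `|m|%N; split=> //; last exact: abs_int.
  by move=> k; rewrite s0 inE => /eqP ->; rewrite /dvdz.
have [|g [og dg ig]] := IH _ sN0; first by move=> k ks; apply: ms; rewrite inE ks orbT.
have [u [v uv]] := Bezoutz m g.
exists `|gcdz m g|%N; split.
- have d : (`|gcdz m g|%N %| g)%N by have := dvdz_gcdr m g; rewrite /dvdz /=.
  exact: dvdn_odd d og.
- move=> k; rewrite inE => /orP[/eqP ->|/dg]; rewrite /dvdz /=.
    by have := dvdz_gcdl m g; rewrite /dvdz.
  by move=> h; apply: dvdn_trans h; have := dvdz_gcdr m g; rewrite /dvdz.
- apply: abs_int; rewrite -uv rmorphD !rmorphM /= mulrDr mulrCA (mulrCA al) -pmulrn.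
  by apply: integral_add; apply: integral_mul => //; apply: integral_id.
Qed.

(** * Real diagonalization and the matrix exponential *)

Lemma horner_mx_similar_diag (F : fieldType) n (P : 'M[F]_n.+1) (d : 'rV[F]_n.+1) p :
  P \in unitmx ->
  horner_mx (invmx P *m diag_mx d *m P) p = invmx P *m diag_mx (map_mx (horner p) d) *m P.
Proof. by move=> Pu; rewrite horner_mx_uconjC // horner_mx_diag. Qed.

(** The complex spectral theorem gives real eigenvalues. The product of ['X - x%:P] over the
    distinct ones annihilates [A], already over [R], so the minimal polynomial of [A] splits over
    [R] with simple roots. *)
Lemma symmetric_real_diagonalizable (R : realType) n (A : 'M[R]_n.+1) :
  A^T = A -> exists P : 'M[R]_n.+1, exists d : 'rV[R]_n.+1,
    P \in unitmx /\ A = invmx P *m diag_mx d *m P.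
Proof.
move=> symA; pose f := real_complex R; pose B := map_mx f A.
have Breal : B \is a mxOver Num.real.
  by apply/mxOverP => i j; rewrite mxE; apply/complex_realP; exists (A i j).
have Bherm : B \is hermsymmx.
  apply: realsym_hermsym => //; apply/is_hermitianmxP.
  by rewrite expr0 scale1r map_mx_id // /B map_trmx symA.
have /hermitian_normalmx/orthomx_spectralP := Bherm.
have := hermitian_spectral_diag_real Bherm.
have := spectral_unit B.
set Q := spectralmx B; set D := spectral_diag B => Qu Dreal BE.
pose rs := undup [seq complex.Re (D 0 i) | i <- enum 'I_n.+1].
have rsA : mxminpoly A %| \prod_(x <- rs) ('X - x%:P).
  apply: mxminpoly_min; apply: (@map_mx_inj _ _ f).
  rewrite map_horner_mx -/B BE horner_mx_similar_diag // map_mx0.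
  set E := map_mx _ D; suff -> : E = 0.
    have -> : diag_mx (0 : 'rV[R[i]]_n.+1) = 0 by apply/matrixP => i j; rewrite !mxE mul0rn.
    by rewrite mulmx0 mul0mx.
  apply/rowP => i; rewrite !mxE.
  have /complex_realP[x Dx] := mxOverP Dreal 0 i.
  rewrite Dx horner_map /=.
  suff /rootP -> : root (\prod_(x <- rs) ('X - x%:P)) x by rewrite rmorph0.
  rewrite root_prod_XsubC mem_undup; apply/mapP; exists i; rewrite ?mem_enum //.
  by rewrite Dx.
have [P Pu /(diagonalizable_forLR Pu)[d dE]] : diagonalizable A.
  by apply/diagonalizableP; exists rs => //; apply: undup_uniq.
by exists P, d; split=> //; rewrite dE mxpoly.conjVmx.
Qed.

Lemma limn_series_lincomb (R : realType) n (c : 'I_n -> R) (u : 'I_n -> R^nat) :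
  (forall j, cvgn (series (u j))) ->
  limn (series (fun k => \sum_j c j * u j k)) = \sum_j c j * limn (series (u j)).
Proof.
move=> cu; apply/cvg_lim => //.
have -> : series (fun k => \sum_j c j * u j k) = fun m => \sum_j c j * series (u j) m.
  apply/funext => m; rewrite /series /= exchange_big /=.
  by apply: eq_bigr => j _; rewrite mulr_sumr.
elim: (index_enum _) => [|j r IH].
  rewrite big_nil; under eq_fun do rewrite big_nil; exact: cvg_cst.
rewrite big_cons; under eq_fun do rewrite big_cons.
by apply: cvgD => //; apply: cvgMl_tmp; apply: cu.
Qed.

Lemma Re_Im_expcoef (R : realType) (t : R) k :
  complex.Re (expcoef t k) = cos_coeff t k /\ complex.Im (expcoef t k) = sin_coeff t k.
Proof.
have -> : expcoef t k = 'i%C ^+ k * ((t ^+ k / k`!%:R)%:C)%C.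
  rewrite /expcoef exprMn -mulrA; congr (_ * _).
  by rewrite rmorphM fmorphV rmorph_nat rmorphXn.
set c := t ^+ k / _.
have -> : cos_coeff t k = (~~ odd k)%:R * (-1) ^+ k./2 * c.
  by rewrite /cos_coeff /= mulrA.
have -> : sin_coeff t k = (odd k)%:R * (-1) ^+ k.-1./2 * c.
  by rewrite /sin_coeff /= mulrA.
have ik : 'i%C ^+ k = if odd k then Complex 0 ((-1) ^+ k.-1./2) else Complex ((-1 : R) ^+ k./2) 0.
  have e m : 'i%C ^+ m.*2 = Complex ((-1 : R) ^+ m) 0.
    by rewrite -mul2n exprM sqr_i complexr0 rmorphXn rmorphN1.
  rewrite -{1}(odd_double_half k); case: ifP => ok; rewrite ?add1n ?add0n ?exprS e //.
  have -> : k.-1./2 = k./2 by move: ok; case: (k) => //= m; rewrite uphalf_half => /negbTE ->.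
  by apply/eqP; rewrite eq_complex /=; apply/andP; split; apply/eqP; ring.
by rewrite ik; case: (odd k) => /=; split; ring.
Qed.

(** The functional calculus: this is [phi(A)] for [A = P^-1 diag(d) P]. *)
Definition fun_mx (R : realType) n (P : 'M[R]_n) (d : 'rV[R]_n) (phi : R -> R) :=
  invmx P *m diag_mx (map_mx phi d) *m P.

Lemma fun_mxE (R : realType) n (P : 'M[R]_n) d phi u v :
  fun_mx P d phi u v = \sum_j (invmx P u j * P j v) * phi (d 0 j).
Proof.
rewrite /fun_mx mxE; apply: eq_bigr => j _; rewrite mxE (bigD1 j) //= big1 ?addr0.
  by rewrite !mxE eqxx mulr1n mulrAC.
by move=> i /negbTE ij; rewrite !mxE ij mulr0n mulr0.
Qed.

(** Each entry of [A ^+ k] is a combination of the powers [d_j ^+ k] with coefficients independent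
    of [k], so the exponential series can be summed eigenvalue by eigenvalue. *)
Lemma expitA_diag (R : realType) n (P : 'M[R]_n.+1) (d : 'rV[R]_n.+1) (t : R) u v :
  P \in unitmx ->
  expitA (invmx P *m diag_mx d *m P) t u v =
    Complex (fun_mx P d (fun x => cos (t * x)) u v) (fun_mx P d (fun x => sin (t * x)) u v).
Proof.
move=> Pu; rewrite mxE !fun_mxE.
have AE k : ((invmx P *m diag_mx d *m P) ^+ k) u v =
    \sum_j (invmx P u j * P j v) * d 0 j ^+ k.
  rewrite -[X in X ^+ k]horner_mx_X -rmorphXn /= horner_mx_similar_diag //.
  by rewrite -/(fun_mx P d _) fun_mxE; apply: eq_bigr => j _; rewrite hornerXn.
congr Complex.
  under [X in limn (series X)]funext => k.
    rewrite AE (Re_Im_expcoef t k).1 mulr_sumr.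
    under eq_bigr => j _.
      have -> : cos_coeff t k * (invmx P u j * P j v * d 0 j ^+ k) =
        (invmx P u j * P j v) * cos_coeff (t * d 0 j) k.
        by rewrite /cos_coeff /= exprMn; ring.
      over.
    over.
  rewrite limn_series_lincomb; last by move=> j; apply: is_cvg_series_cos_coeff.
  by apply: eq_bigr => j _; rewrite cos.unlock.
under [X in limn (series X)]funext => k.
  rewrite AE (Re_Im_expcoef t k).2 mulr_sumr.
  under eq_bigr => j _.
    have -> : sin_coeff t k * (invmx P u j * P j v * d 0 j ^+ k) =
      (invmx P u j * P j v) * sin_coeff (t * d 0 j) k.
      by rewrite /sin_coeff /= exprMn; ring.
    over.
  over.
rewrite limn_series_lincomb; last by move=> j; apply: is_cvg_series_sin_coeff.
by apply: eq_bigr => j _; rewrite sin.unlock.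
Qed.

(** * Cosine and sine at shifts by multiples of pi *)

Lemma cosDmulpi (R : realType) (x : R) (m : int) :
  cos (x + pi * m%:~R) = (-1) ^+ `|m|%N * cos x.
Proof.
case: m => m; first by rewrite mulrzr; apply: alternatingn; apply: cosDpi.
have := alternatingn (@cosDpi R) m.+1 (x - pi *+ m.+1); rewrite subrK => ->.
by rewrite NegzE abszN mulrNz mulrN mulrzr mulrA -expr2 sqrr_sign mul1r.
Qed.

Lemma sinDmulpi (R : realType) (x : R) (m : int) :
  sin (x + pi * m%:~R) = (-1) ^+ `|m|%N * sin x.
Proof. by rewrite -!cosBpihalf addrAC cosDmulpi. Qed.

(** Reduce [x] modulo [pi] to [y] in [[0, pi)]. There the sine vanishes only at 0, and the sign of
    the cosine then gives the parity. *)
Lemma cos_eqN1 (R : realType) (x : R) : cos x = -1 ->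
  exists2 m : int, odd `|m| & x = pi * m%:~R.
Proof.
move=> cx; have p0 := pi_gt0 R.
pose m := Num.floor (x / pi); pose y := x - pi * m%:~R.
have xE : x = y + pi * m%:~R by rewrite subrK.
have y0 : 0 <= y by rewrite subr_ge0 mulrC -ler_pdivlMr // floor_le.
have y1 : y < pi.
  rewrite ltrBlDr -{1}[pi]mulr1 -mulrDr addrC -ltr_pdivrMl // mulrC.
  by have /andP[_] := floor_itv (x / pi); rewrite rmorphD.
have sy : sin y = 0.
  have := cos1sin0 (x := x); rewrite cx normrN1 => /(_ erefl).
  by rewrite xE sinDmulpi => /eqP; rewrite mulf_eq0 signr_eq0 => /eqP.
have yz : y = 0.
  apply/eqP; rewrite eq_le y0 andbT leNgt; apply/negP => yp.
  by have := @sin_gt0_pi R y; rewrite yp y1 sy ltxx => /(_ isT).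
exists m; last by rewrite {1}xE yz add0r.
move: cx; rewrite xE yz cosDmulpi cos0 mulr1 -signr_odd.
by case: (odd _) => //; rewrite expr0 => h; have : (1 : R) > 0 by []; lra.
Qed.

(** * Rationality of minimal polynomials and of sums of squared differences *)

(* The polynomial on the left is the minimal polynomial of the vector [u0] relative to
   the matrix: its coefficients solve a linear system over [F] that has full rank. *)
Lemma krylov_minpoly_descends (F K : fieldType) (f : {rmorphism F -> K}) n
    (A0 : 'M[F]_n.+1) (u0 : 'cV[F]_n.+1) (P : 'M[K]_n.+1) (d : 'rV[K]_n.+1) :
  P \in unitmx -> map_mx f A0 = invmx P *m diag_mx d *m P ->
  exists p : {poly F},
    \prod_(x <- undup [seq d 0 j | j <- enum 'I_n.+1 & (P *m map_mx f u0) j 0 != 0])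
      ('X - x%:P) = map_poly f p.
Proof.
move=> Pu AE; set A := map_mx f A0 in AE; set u := map_mx f u0.
set T := undup _; pose k := size T; set G := \prod_(x <- T) _.
(* In the coordinates [P *m u], the matrix [q(A)] multiplies coordinate [j] by [q(d_j)]. *)
have kill (q : {poly K}) : horner_mx A q *m u = 0 <->
    forall j, (P *m u) j 0 != 0 -> q.[d 0 j] = 0.
  rewrite AE horner_mx_similar_diag // -!mulmxA; split=> [h j zj|h].
    have /colP/(_ j) : diag_mx (map_mx (horner q) d) *m (P *m u) = 0.
      by rewrite -[LHS](mulKVmx Pu) h mulmx0.
    rewrite mul_diag_mx !mxE => /eqP; rewrite mulf_eq0 => /orP[/eqP //|/eqP z0].
    by case/eqP: zj; rewrite mxE.
  suff -> : diag_mx (map_mx (horner q) d) *m (P *m u) = 0 by rewrite mulmx0.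
  apply/colP => j; rewrite mul_diag_mx mxE [map_mx _ _ _ _]mxE [RHS]mxE.
  by have [->|/h ->] := eqVneq ((P *m u) j 0) 0; rewrite ?mulr0 ?mul0r.
have memT x : reflect (exists2 j, (P *m u) j 0 != 0 & x = d 0 j) (x \in T).
  rewrite mem_undup; apply: (iffP mapP) => [[j]|[j]].
    by rewrite mem_filter => /andP[? _] ->; exists j.
  by move=> zj ->; exists j; rewrite // mem_filter zj mem_enum.
(* The Krylov matrix, with rows [A0^i u0] for [i < k]. Its rows are independent: a relation would be
   a nonzero polynomial of degree below [k] with [k] distinct roots. *)
pose M0 : 'M[F]_(k, n.+1) := \matrix_(i < k) (A0 ^+ i *m u0)^T.
pose M := map_mx f M0.
have fX i : map_mx f (A0 ^+ i) = A ^+ i by rewrite rmorphXn.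
have ME (c : 'rV[K]_k) : c *m M = (horner_mx A (rVpoly c) *m u)^T.
  rewrite mulmx_sum_row [rVpoly c]poly_def linear_sum /= mulmx_suml linear_sum.
  apply: eq_bigr => i _; rewrite valK /= linearZ /= -scalemxAl linearZ /=.
  congr (_ *: _); rewrite rmorphXn /= horner_mx_X -map_row rowK -fX -map_mxM.
  by rewrite map_trmx.
have freeM : row_free M.
  apply: inj_row_free => v; rewrite ME => /(congr1 trmx); rewrite trmxK trmx0.
  move/kill => h; rewrite -[v]rVpolyK (_ : rVpoly v = 0) ?linear0 //.
  have [//|nz] := eqVneq (rVpoly v) 0.
  have : all (root (rVpoly v)) T by apply/allP => x /memT[j zj ->]; apply/rootP/h.
  by move=> /(max_poly_roots nz)/(_ (undup_uniq _)); rewrite ltnNge size_poly.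
have sG : size G = k.+1 by rewrite size_prod_XsubC.
have mG : G`_k = 1.
  have /monicP := monic_prod_XsubC T xpredT id.
  by rewrite lead_coefE sG.
have sH : (size ('X^k - G)%R <= k)%N.
  apply/leq_sizeP => j; rewrite leq_eqVlt => /orP[/eqP <-|kj].
    by rewrite coefB coefXn eqxx mG subrr.
  by rewrite coefB coefXn gtn_eqF // nth_default ?subrr // sG.
have Gu : horner_mx A G *m u = 0.
  apply/kill => j zj; apply/rootP; rewrite root_prod_XsubC; apply/memT.
  by exists j.
(* As [G] kills [u], the coefficients of ['X^k - G] express [A^k u] through the rows of [M]. By full
   rank they are unique and given by the pseudo-inverse, which commutes with [f]; hence they come
   from [F]. *)
have cE : poly_rV ('X^k - G) = map_mx f ((A0 ^+ k *m u0)^T *m pinvmx M0).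
  rewrite map_mxM map_pinvmx -/M -[LHS](mulmxKp freeM) ME poly_rV_K //.
  congr (_ *m _); rewrite rmorphB /= rmorphXn /= horner_mx_X mulmxBl -fX Gu subr0.
  by rewrite -map_trmx map_mxM.
exists ('X^k - rVpoly ((A0 ^+ k *m u0)^T *m pinvmx M0)).
rewrite rmorphB /= map_polyXn map_rVpoly -cE poly_rV_K //.
by rewrite opprB addrC subrK.
Qed.

(** Expanding the squares leaves only the first two power sums of [S] and of [T], which are rational
    by Newton's identities. *)
Lemma rational_sum_sqr_differences (K : numFieldType) (S T : seq K) (p q : {poly rat}) :
  \prod_(x <- S) ('X - x%:P) = map_poly ratr p ->
  \prod_(y <- T) ('X - y%:P) = map_poly ratr q ->
  exists r : rat, \sum_(x <- S) \sum_(y <- T) (x - y) ^+ 2 = ratr r.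
Proof.
have power_sums (s : seq K) (f : {poly rat}) :
    \prod_(x <- s) ('X - x%:P) = map_poly ratr f ->
    exists r1 r2 : rat, \sum_(x <- s) x = ratr r1 /\ \sum_(x <- s) x ^+ 2 = ratr r2.
  move=> sf; have [] := prod_XsubC_top_coefs s; rewrite sf.
  rewrite -(map_polyXn (ratr : rat -> K)) -(map_polyX (ratr : rat -> K)) -!rmorphM /= !coef_map /=.
  set c1 := _`_ _; set c2 := _`_ _ => e1 e2.
  exists (- c1), (c1 ^+ 2 - c2 *+ 2); split; first by rewrite rmorphN /= e1 opprK.
  by rewrite rmorphB rmorphXn rmorphMn /= e1 e2; ring.
move=> /power_sums[s1 [s2 [Es1 Es2]]] /power_sums[t1 [t2 [Et1 Et2]]].
exists (s2 *+ size T - s1 * t1 *+ 2 + t2 *+ size S).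
rewrite rmorphD rmorphB !rmorphMn rmorphM /= -Es1 -Es2 -Et1 -Et2.
have inner x : \sum_(y <- T) (x - y) ^+ 2 =
    x ^+ 2 *+ size T - x * (\sum_(y <- T) y) *+ 2 + \sum_(y <- T) y ^+ 2.
  under eq_bigr do rewrite sqrrB.
  rewrite big_split sumrB /= big_const_seq count_predT iter_addr_0.
  by rewrite sumrMnl mulr_sumr.
under eq_bigr do rewrite inner.
rewrite big_split sumrB /= big_const_seq count_predT iter_addr_0.
by rewrite !sumrMnl mulr_suml.
Qed.

(** * State transfer in eigenvector coordinates *)

(** Multiplying [exp(itA) e_a = gamma e_b] by [P] decouples it into
    [exp(i t d_j) P_ja = gamma P_jb]; here [gamma = g1 + i g2], and the real and imaginary parts are
    separated. *)
Lemma pst_diag (R : realType) n (P : 'M[R]_n.+1) (d : 'rV[R]_n.+1) a b t :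
  P \in unitmx ->
  pst (invmx P *m diag_mx d *m P) a b t <->
  exists g1 g2 : R, g1 ^+ 2 + g2 ^+ 2 = 1 /\
    forall j, cos (t * d 0 j) * P j a = g1 * P j b /\ sin (t * d 0 j) * P j a = g2 * P j b.
Proof.
move=> Pu.
have key phi g : (forall u, fun_mx P d phi u a = g * (u == b)%:R) <->
    (forall j, phi (d 0 j) * P j a = g * P j b).
  have -> : (forall u, fun_mx P d phi u a = g * (u == b)%:R) <->
      col a (fun_mx P d phi) = g *: delta_mx b 0.
    by split=> [h|/colP h u]; [apply/colP => u|]; have := h u; rewrite !mxE ?andbT // eqxx andbT.
  have -> : (forall j, phi (d 0 j) * P j a = g * P j b) <->
      diag_mx (map_mx phi d) *m col a P = g *: col b P.
    split=> [h|/colP h j]; [apply/colP => j|]; have := h j; by rewrite mul_diag_mx !mxE.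
  rewrite /fun_mx !colE -!mulmxA; split=> [h|->].
    by rewrite -[LHS](mulKVmx Pu) h -scalemxAr.
  by rewrite -scalemxAr mulKmx.
split.
  move=> [[g1 g2] [g_norm h]]; exists g1, g2; split.
    by have := add_Re2_Im2 (Complex g1 g2); rewrite g_norm expr1n => -[].
  have e1 : forall u, fun_mx P d (fun x => cos (t * x)) u a = g1 * (u == b)%:R.
    move=> u; have /(congr1 (@complex.Re R)) := h u; rewrite expitA_diag //=.
    by case: (u == b) => /= ->; ring.
  have e2 : forall u, fun_mx P d (fun x => sin (t * x)) u a = g2 * (u == b)%:R.
    move=> u; have /(congr1 (@complex.Im R)) := h u; rewrite expitA_diag //=.
    by case: (u == b) => /= ->; ring.
  by move=> j; split; [apply: (key _ _).1 e1 j|apply: (key _ _).1 e2 j].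
move=> [g1 [g2 [g_norm h]]]; exists (Complex g1 g2); split.
  by rewrite normc_def /= g_norm sqrtr1.
move=> u; rewrite expitA_diag //.
rewrite ((key (fun x => cos (t * x)) g1).2 (fun j => (h j).1)).
rewrite ((key (fun x => sin (t * x)) g2).2 (fun j => (h j).2)).
by apply/eqP; rewrite eq_complex; case: (u == b) => /=; apply/andP; split; apply/eqP; ring.
Qed.

(** * Integrality and the parity obstruction *)

(** Row [j] of [P] is a left eigenvector, so [d_j] is a root of the monic integer characteristic
    polynomial. *)
Lemma eigenvalue_integral (K : fieldType) n (A0 : 'M[int]_n.+1) (P : 'M[K]_n.+1) d :
  P \in unitmx -> map_mx intr A0 = invmx P *m diag_mx d *m P ->
  forall j, integral (d 0 j).
Proof.
move=> Pu AE j; exists (char_poly A0); first exact: char_poly_monic.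
rewrite map_char_poly -eigenvalue_root_char; apply/eigenvalueP; exists (row j P).
  rewrite AE -row_mul !mulmxA mulmxV // mul1mx mul_diag_mx.
  by apply/rowP => i; rewrite !mxE.
apply/eqP => rj0; have : row j (P *m invmx P) = 0 by rewrite row_mul rj0 mul0mx.
rewrite mulmxV // => /rowP/(_ j); rewrite !mxE eqxx => /eqP.
by rewrite oner_eq0.
Qed.

Lemma integral_sum (K : comUnitRingType) (I : Type) (r : seq I) (P : pred I) (F : I -> K) :
  (forall i, P i -> integral (F i)) -> integral (\sum_(i <- r | P i) F i).
Proof.
move=> h; apply: (big_ind (fun x => integral x)) => //; first exact: integral0.
exact: integral_add.
Qed.

Lemma integral_horner_mx (K : fieldType) n (A : 'M[K]_n.+1) (p : {poly int}) :
  (forall i j, integral (A i j)) ->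
  forall i j, integral (horner_mx A (map_poly intr p) i j).
Proof.
move=> iA; elim/poly_ind: p => [|p c IH] i j.
  by rewrite !rmorph0 mxE; apply: integral0.
rewrite !rmorphD !rmorphM /= map_polyX map_polyC horner_mx_X horner_mx_C mxE.
apply: integral_add.
  by rewrite mxE; apply: integral_sum => k _; apply: integral_mul.
rewrite mxE; case: (i == j); [exact: integral_id|exact: integral0].
Qed.

Lemma half_not_integral (K : numFieldType) : ~ integral (2^-1 : K).
Proof.
have -> : (2^-1 : K) = ratr (2^-1 : rat) by rewrite fmorphV /= rmorph_nat.
case/integral_ratr => z /(congr1 (fun x => x * 2)); rewrite mulVf // => h.
have /eqP : (1 = z * 2 :> int) by apply: (@intr_inj rat); rewrite rmorphM.
by lia.
Qed.

(** This is what excludes [be = 1]. Shifting by [th] turns the relevant eigenvalues into the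
    integers [o j], while the entries of [A - th] remain algebraic integers. *)
Lemma supports_not_odd_apart (R : numFieldType) n (A : 'M[R]_n.+1) (P : 'M[R]_n.+1)
    (d : 'rV[R]_n.+1) (a b : 'I_n.+1) (th : R) (o : 'I_n.+1 -> int) :
  P \in unitmx -> A = invmx P *m diag_mx d *m P ->
  (forall i j, integral (A i j)) -> integral th -> a != b ->
  (forall j, (P j a + P j b != 0) || (P j a - P j b != 0) -> d 0 j = th + (o j)%:~R) ->
  ~ (forall j k, P j a + P j b != 0 -> P k a - P k b != 0 -> odd `|o j - o k|).
Proof.
move=> Pu AE iA ith ab od oo.
pose f := \prod_(j | P j a + P j b != 0) ('X - (o j)%:P).
pose h := \prod_(j | P j a - P j b != 0) ('X - (o j)%:P).
have [U [V [W E]]] : coprime_mod2 f h.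
  apply: coprime_mod2_prod => j pj; apply/coprime_mod2C.
  apply: coprime_mod2_prod => k pk; apply/coprime_mod2C.
  exact/coprime_mod2_XsubC/oo.
pose N := A - th%:M.
have NE : N = invmx P *m diag_mx (d - const_mx th) *m P.
  rewrite linearB /= mulmxBr mulmxBl -AE diag_const_mx scalar_mxC -mulmxA.
  by rewrite mulVmx // mulmx1.
pose H (p : {poly int}) := horner_mx N (map_poly intr p).
have iH p i j : integral (H p i j).
  apply: integral_horner_mx => {}i {}j; rewrite !mxE; apply: integral_sub => //.
  by case: (i == j) => //; apply: integral0.
pose ea : 'cV[R]_n.+1 := delta_mx a 0; pose eb : 'cV[R]_n.+1 := delta_mx b 0.
have kill p (v : 'cV[R]_n.+1) :
    (forall j, (P *m v) j 0 != 0 -> (map_poly intr p).[d 0 j - th] = 0) -> H p *m v = 0.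
  move=> hp; rewrite /H NE horner_mx_similar_diag // -!mulmxA.
  suff -> : diag_mx (map_mx (horner (map_poly intr p)) (d - const_mx th)) *m (P *m v) = 0.
    by rewrite mulmx0.
  apply/colP => j; rewrite mul_diag_mx mxE [X in X * _]mxE [RHS]mxE.
  have [->|/hp] := eqVneq ((P *m v) j 0) 0; rewrite ?mulr0 //.
  by rewrite !mxE => ->; rewrite mul0r.
have rootf (Q : pred 'I_n.+1) j : Q j -> d 0 j = th + (o j)%:~R ->
    (map_poly (intr : int -> R) (\prod_(i | Q i) ('X - (o i)%:P))).[d 0 j - th] = 0.
  move=> Qj ->; rewrite addrC addKr horner_map /= (bigD1 j) //= hornerM.
  by rewrite hornerXsubC subrr mul0r.
have Pab j : ((P *m (ea + eb)) j 0 = P j a + P j b) * ((P *m (ea - eb)) j 0 = P j a - P j b).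
  by rewrite mulmxDr mulmxBr -!colE !mxE.
have fu : H f *m (ea + eb) = 0.
  by apply: kill => j; rewrite Pab => pj; apply: rootf => //; apply: od; rewrite pj.
have hw : H h *m (ea - eb) = 0.
  by apply: kill => j; rewrite Pab => pj; apply: rootf => //; apply: od; rewrite pj orbT.
have HE : H U *m H f + H V *m H h = 1%:M + (H W + H W).
  have := congr1 H E; rewrite mulr2n /H !rmorphD !rmorphM !rmorph1; apply.
(* Apply the Bezout identity to [ea + eb]. The [f] term vanishes, and in the [h] term
   [ea + eb = (ea - eb) + 2 eb] leaves only [2 eb]. *)
have : ea + eb = (H V *m H h *m eb - H W *m (ea + eb)) *+ 2.
  have := congr1 (mulmx^~ (ea + eb)) HE.
  have hu : H h *m (ea + eb) = (H h *m eb) *+ 2.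
    have -> : ea + eb = (ea - eb) + eb *+ 2 by rewrite mulr2n addrA subrK.
    by rewrite mulmxDr hw add0r mulr2n mulmxDr -mulr2n.
  rewrite /= !mulmxDl mul1mx -!(mulmxA _ _ (ea + eb)) fu mulmx0 add0r.
  rewrite hu mulr2n mulmxDr -mulr2n mulmxA -mulr2n.
  by rewrite mulrnBl => ->; rewrite addrK.
set Y := _ - _ => eY.
(* Entry [a] of [ea + eb] is 1, so its half [Y a 0], an algebraic integer, would be [1/2]. *)
have e : 1 = Y a 0 *+ 2.
  transitivity ((ea + eb) a 0); first by rewrite !mxE !eqxx (negbTE ab) addr0.
  by rewrite eY [in LHS]mulr2n mxE -mulr2n.
have iM (B C : 'M[R]_n.+1) : (forall i j, integral (B i j)) ->
    (forall i j, integral (C i j)) -> forall i j, integral ((B *m C) i j).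
  by move=> iB iC i j; rewrite mxE; apply: integral_sum => k _; apply: integral_mul.
have iY : integral (Y a 0).
  rewrite /Y mulmxDr -!colE !mxE; apply: integral_sub.
    by have := iM _ _ (iH V) (iH h) a b; rewrite mxE.
  exact: integral_add.
apply: (@half_not_integral R); suff -> : 2^-1 = Y a 0 by [].
have n2 : (2 : R) != 0 by rewrite pnatr_eq0.
by apply: (mulIf n2); rewrite mulVf // mulr_natr.
Qed.

(** * The bound on the minimum transfer time *)

Theorem theorem14 (R : realType) (n : nat) (e : rel 'I_n) (a b : 'I_n) (t : R) :
  simple_graph e -> a != b ->
  0 < t -> pst (adjmx R e) a b t ->
  (forall s : R, 0 < s -> s < t -> ~ pst (adjmx R e) a b s) ->
  t <= pi / Num.sqrt 2.
Proof.
case: n e a b => [e []//|n e a b] [symE _] ab t0 pst_t t_min.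
have AT : (adjmx R e)^T = adjmx R e by apply/matrixP => i j; rewrite !mxE symE.
have [P [d [Pu AE]]] := symmetric_real_diagonalizable AT.
have iA i j : integral (adjmx R e i j) by rewrite mxE; apply: integral_nat.
have AEq : map_mx ratr (\matrix_(u, v) (e u v)%:R : 'M[rat]_n.+1) = adjmx R e.
  by apply/matrixP => i j; rewrite !mxE ratr_nat.
have AEz : map_mx intr (\matrix_(u, v) (e u v)%:R : 'M[int]_n.+1) = adjmx R e.
  by apply/matrixP => i j; rewrite !mxE rmorph_nat.
have id := eigenvalue_integral Pu (etrans AEz AE).
pose Jp j := P j a + P j b != 0; pose Jm j := P j a - P j b != 0.
have [g1 [g2 [gg pE]]] : exists g1 g2 : R, g1 ^+ 2 + g2 ^+ 2 = 1 /\
    forall j, cos (t * d 0 j) * P j a = g1 * P j b /\ sin (t * d 0 j) * P j a = g2 * P j b.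
  by apply/pst_diag => //; rewrite -AE.
(* Comparing moduli in the transfer equations gives [P_ja^2 = P_jb^2], so no index lies in both [Jp]
   and [Jm]. *)
have Pab j : (P j a - P j b) * (P j a + P j b) = 0.
  have [hc hs] := pE j; rewrite -subr_sqr; apply/eqP; rewrite subr_eq0; apply/eqP.
  rewrite -[LHS]mul1r -(cos2Dsin2 (t * d 0 j)) mulrDl -!exprMn hc hs !exprMn.
  by rewrite -mulrDl gg mul1r.
have Jp_eq j : Jp j -> P j a = P j b /\ P j a != 0.
  move=> Jj; have := Pab j; move/eqP; rewrite mulf_eq0 (negbTE Jj) orbF subr_eq0.
  move/eqP => ej; split=> //; apply: contraNneq Jj => z.
  by rewrite -ej z addr0.
have Jm_eq j : Jm j -> P j a = - P j b /\ P j a != 0.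
  move=> Jj; have := Pab j; move/eqP; rewrite mulf_eq0 (negbTE Jj) /= addr_eq0.
  move/eqP => ej; split=> //; apply: contraNneq Jj => z.
  by apply/eqP; lra.
have exists_support (v : 'cV[R]_n.+1) : v != 0 -> exists j, (P *m v) j 0 != 0.
  move=> v0; apply: contrapT => h; case/eqP: v0.
  rewrite -(mulKmx Pu v); suff -> : P *m v = 0 by rewrite mulmx0.
  apply/colP => j; rewrite [RHS]mxE; apply: contrapT => /eqP h'; apply: h; by exists j.
pose u0 : 'cV[rat]_n.+1 := delta_mx a 0 + delta_mx b 0.
pose w0 : 'cV[rat]_n.+1 := delta_mx a 0 - delta_mx b 0.
have PuE j : (P *m map_mx ratr u0) j 0 = P j a + P j b.
  by rewrite /u0 map_mxD !map_delta_mx mulmxDr -!colE !mxE.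
have PwE j : (P *m map_mx ratr w0) j 0 = P j a - P j b.
  by rewrite /w0 map_mxB !map_delta_mx mulmxBr -!colE !mxE.
have [r0 Jr0] : exists j, Jp j.
  have [|j] := exists_support (map_mx ratr u0); last by rewrite PuE; exists j.
  rewrite map_mx_eq0; apply/eqP => /colP/(_ a); rewrite !mxE !eqxx (negbTE ab) addr0.
  by move/eqP; rewrite oner_eq0.
have [s0 Js0] : exists j, Jm j.
  have [|j] := exists_support (map_mx ratr w0); last by rewrite PwE; exists j.
  rewrite map_mx_eq0; apply/eqP => /colP/(_ a); rewrite !mxE !eqxx (negbTE ab) subr0.
  by move/eqP; rewrite oner_eq0.
pose al := pi / t; have al0 : 0 < al by rewrite divr_gt0 // pi_gt0.
(* The phase [exp(i t d_j)] is [gamma] on [Jp] and [-gamma] on [Jm], so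
   [cos (t * (d_r - d_s)) = -1]. *)
have diff r s : Jp r -> Jm s -> exists2 m : int, odd `|m| & d 0 r - d 0 s = al * m%:~R.
  move=> /Jp_eq[er nr] /Jm_eq[es ns].
  have [] := pE r; rewrite -er => /(mulIf nr) cr /(mulIf nr) sr.
  have [] := pE s; rewrite -[P s b]opprK -es !mulrN -!mulNr => /(mulIf ns) cs /(mulIf ns) ss.
  have [|m om xm] := @cos_eqN1 R (t * (d 0 r - d 0 s)).
    by rewrite mulrBr cosB cr cs sr ss -gg; ring.
  exists m => //; rewrite /al mulrAC -xm; field; exact: lt0r_neq0.
(* On [Jp] and [Jm] the quotient is an integer by [diff], and the floor extracts it. *)
pose m r s : int := Num.floor ((d 0 r - d 0 s) / al).
have mE r s : Jp r -> Jm s -> odd `|m r s| /\ d 0 r - d 0 s = al * (m r s)%:~R.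
  by move=> /diff h /h[k ok ek]; rewrite /m ek mulrAC divff ?lt0r_neq0 // mul1r intrKfloor.
pose ms := [seq m r s | r <- enum Jp, s <- enum Jm].
have [| |g [og dg ig]] := @odd_gcd_combination R al ms.
- move=> k /allpairsP[[r s] /=]; rewrite !mem_enum => -[Jr Js ->].
  have [om xm] := mE r s Jr Js; split=> //; rewrite -xm; exact: integral_sub.
- have : m r0 s0 \in ms by apply: allpairs_f; rewrite mem_enum.
  by case: (ms).
pose be := al * g%:R.
have g0 : (0 < g)%N by case: (g) og.
have be0 : 0 < be by rewrite mulr_gt0 // ltr0n.
have diff' r s : Jp r -> Jm s -> exists2 k : int, odd `|k| & d 0 r - d 0 s = be * k%:~R.
  move=> Jr Js; have [om xm] := mE r s Jr Js.
  have : m r s \in ms by apply: allpairs_f; rewrite mem_enum.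
  move/dg/dvdzP => [k mk]; exists k.
    by move: om; rewrite mk abszM oddM => /andP[].
  by rewrite xm mk /be rmorphM /= -pmulrn; ring.
have shiftp j : Jp j -> exists2 k : int, odd `|k| & d 0 j = d 0 s0 + be * k%:~R.
  by move=> /diff'/(_ Js0)[k ok xk]; exists k; rewrite // -xk addrC subrK.
(* Two odd multiples of [be], both measured from the positive eigenvalue [d_r0], differ by an even
   one. *)
have shiftm j : Jm j -> exists2 k : int, ~~ odd `|k| & d 0 j = d 0 s0 + be * k%:~R.
  move=> Jj; have [k1 o1 x1] := diff' _ _ Jr0 Js0; have [k2 o2 x2] := diff' _ _ Jr0 Jj.
  exists (k1 - k2); first by lia.
  by rewrite rmorphB /= mulrBr -x1 -x2; ring.
(* At time [pi / be] the offset [be * k] contributes the sign [(-1)^k], odd on [Jp] and even on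
   [Jm], so the phase [-exp(i x)] works. Outside both classes [P_ja = P_jb = 0]. *)
have pst_g : pst (adjmx R e) a b (pi / be).
  rewrite AE; apply/pst_diag => //; pose x := pi / be * d 0 s0.
  exists (- cos x), (- sin x); split; first by rewrite !sqrrN cos2Dsin2.
  have xE k : pi / be * (d 0 s0 + be * k%:~R) = x + pi * k%:~R.
    by rewrite mulrDr -/x; congr (_ + _); field; apply: lt0r_neq0.
  move=> j; have [Jj|nJp] := boolP (Jp j).
    have [k ok ->] := shiftp j Jj; have [<- _] := Jp_eq j Jj.
    by rewrite xE cosDmulpi sinDmulpi -signr_odd ok expr1 !mulN1r.
  have [Jj|nJm] := boolP (Jm j).
    have [k ok ->] := shiftm j Jj; have [-> _] := Jm_eq j Jj.
    rewrite xE cosDmulpi sinDmulpi -signr_odd (negbTE ok) expr0 !mul1r.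
    by rewrite !mulrN !mulNr.
  move: nJp nJm; rewrite /Jp /Jm !negbK => /eqP h1 /eqP h2.
  have [-> ->] : P j a = 0 /\ P j b = 0 by split; lra.
  by rewrite !mulr0.
have t_le : t <= pi / be.
  rewrite leNgt; apply/negP => lt; apply: (t_min _ _ lt) => //.
  by rewrite divr_gt0 // pi_gt0.
apply: le_trans t_le _; rewrite ler_pM2l ?pi_gt0 // lef_pV2 ?posrE ?sqrtr_gt0 //.
have [q be2] : exists q : rat, be ^+ 2 = ratr q.
  have [p1 Ep1] := krylov_minpoly_descends u0 Pu (etrans AEq AE).
  have [p2 Ep2] := krylov_minpoly_descends w0 Pu (etrans AEq AE).
  have [r] := rational_sum_sqr_differences Ep1 Ep2.
  set S := undup _; set T := undup _ => rE.
  have memS x : reflect (exists2 j, Jp j & x = d 0 j) (x \in S).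
    rewrite mem_undup; apply: (iffP mapP) => [[j]|[j]].
      by rewrite mem_filter PuE => /andP[? _] ->; exists j.
    by move=> zj ->; exists j; rewrite // mem_filter PuE mem_enum andbT.
  have memT x : reflect (exists2 j, Jm j & x = d 0 j) (x \in T).
    rewrite mem_undup; apply: (iffP mapP) => [[j]|[j]].
      by rewrite mem_filter PwE => /andP[? _] ->; exists j.
    by move=> zj ->; exists j; rewrite // mem_filter PwE mem_enum andbT.
  pose c x y : int := Num.floor ((x - y) / be).
  have cE x y : x \in S -> y \in T -> odd `|c x y| /\ x - y = be * (c x y)%:~R.
    move=> /memS[i Ji ->] /memT[j Jj ->]; have [k ok ek] := diff' _ _ Ji Jj.
    by rewrite /c ek mulrAC divff ?lt0r_neq0 // mul1r intrKfloor.
  (* The rational sum of squared differences equals [be^2 * K]. Here [K] is positive because it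
     contains the square of an odd integer. *)
  pose K : int := \sum_(x <- S) \sum_(y <- T) c x y ^+ 2.
  have KE : be ^+ 2 * K%:~R = ratr r.
    rewrite -rE /K rmorph_sum mulr_sumr /=; apply: eq_big_seq => x xS.
    rewrite rmorph_sum mulr_sumr /=; apply: eq_big_seq => y yT.
    by have [_ ->] := cE x y xS yT; rewrite rmorphXn /= -exprMn.
  have K0 : 0 < K.
    have sS : d 0 r0 \in S by apply/memS; exists r0.
    have sT : d 0 s0 \in T by apply/memT; exists s0.
    rewrite /K (big_rem _ sS) /= (big_rem _ sT) /= -addrA ltr_wpDr //.
      rewrite addr_ge0 ?sumr_ge0 // => *; rewrite ?sqr_ge0 ?sumr_ge0 // => *.
      exact: sqr_ge0.
    have [ok _] := cE _ _ sS sT; rewrite exprn_even_gt0 //=.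
    by apply: contraTneq ok => ->.
  exists (r / K%:~R); rewrite fmorph_div /= -KE ratr_int mulfK //.
  by rewrite intr_eq0 lt0r_neq0.
have [z qz] : exists z : int, q = z%:~R.
  by apply: (@integral_ratr R); rewrite -be2 expr2; apply: integral_mul.
rewrite qz ratr_int in be2.
have z0 : 0 < z by rewrite -(ltr0z R) -be2 exprn_gt0.
have z1 : z != 1.
  apply/eqP => z1; have be1 : be = 1.
    by apply/eqP; rewrite -(@pexpr_eq1 _ _ 2) ?ltW // be2 z1.
  (* With [be = 1] all eigenvalues in the two classes are integer shifts of [d_s0], which serves as
     [th]. *)
  pose o j : int := Num.floor (d 0 j - d 0 s0).
  have oE j : Jp j || Jm j -> d 0 j = d 0 s0 + (o j)%:~R.
    move=> Jj; have [k xk] : exists k : int, d 0 j = d 0 s0 + k%:~R.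
      by case/orP: Jj => [/shiftp|/shiftm] [k _]; rewrite be1 mul1r; exists k.
    by rewrite /o xk [X in Num.floor X]addrC addKr intrKfloor.
  apply: (supports_not_odd_apart Pu AE iA (id s0) ab oE) => j k Jj Jk.
  have [i oi] := diff' _ _ Jj Jk.
  rewrite be1 mul1r (oE j (introT orP (or_introl Jj))) (oE k (introT orP (or_intror Jk))).
  rewrite opprD addrACA subrr add0r -rmorphB /= => /intr_inj ->.
  exact: oi.
have : (2 : R) <= be ^+ 2 by rewrite be2 -[2]/(2%:~R) ler_int; lia.
by move/ler_wsqrtr; rewrite sqrtr_sqr gtr0_norm.
Qed.
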